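(* Let $\lambda>0$ and let $$Q(x,y)=\left(-x(a_{10}x^2+a_{11}y^2),\,-y(a_{20}x^2+a_{21}y^2)\right)$$ be a contracting cubic $\mathbb{Z}_2\oplus\mathbb{Z}_2$-equivariant vector field, with real coefficients $a_{ij}$. Put $A=a_{10}-a_{20}$ and $B=a_{21}-a_{11}$. Then the dynamics of $\dot X=\lambda X+Q(X)$ in the invariant circle is the following: (I) If $A=B=0$ then $\sigma(\mathcal{L}Q)=\infty$. (II) If $AB=0$ and $A+B\ne0$ then $\sigma(\mathcal{L}Q)=(1+)(1-)$ and one of the equilibria is not hyperbolic. (III) If $AB<0$ then $\sigma(\mathcal{L}Q)=(1+)(1-)$. (IV) If $AB>0$ then $\sigma(\mathcal{L}Q)=(1+)(1-)(1+)(1-)$. Moreover, in cases (III) and (IV) all equilibria are hyperbolic.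
   Context: $Q$ is contracting if $\langle X,Q(X)\rangle<0$ for all $X\in\mathbb{R}^2$ with $\|X\|=1$. $\mathbb{Z}_2\oplus\mathbb{Z}_2$ is the group generated by $(x,y)\mapsto(-x,y)$ and $(x,y)\mapsto(x,-y)$; the form of $Q$ displayed is the general cubic equivariant form. For $X=(x,y)$, $\mathcal{L}Q(X)=\langle X^\perp,Q(X)\rangle$ with $X^\perp=(-y,x)$; here $\mathcal{L}Q(x,y)=xy(Ax^2-By^2)$. For contracting $Q$ and $\lambda>0$ the system has a unique invariant topological circle in $\mathbb{R}^2\setminus\{0\}$ (the invariant circle), surrounding the origin and attracting all trajectories with nonzero initial condition; the flow on it is topologically equivalent to that of $\dot\theta=g(\theta)$, $g(\theta)=\mathcal{L}Q(\cos\theta,\sin\theta)$. The symbol sequence $\sigma(\mathcal{L}Q)$ is the cyclic oriented list $(j_1s_1),\ldots,(j_\ell s_\ell)$ obtained from the ordered zeros $0\le\theta_1<\cdots<\theta_\ell<\pi$ of $g$ (each zero in $[0,\pi)$ represents an antipodal pair of equilibria on the invariant circle, and equilibria are counted up to this antipodal symmetry): $j_i=1$ if the multiplicity of $\theta_i$ is odd and $j_i=2$ if it is even; if $j_i=1$, $s_i=+$ if $g$ is increasing around $\theta_i$ and $s_i=-$ if decreasing; if $j_i=2$, $s_i=+$ if $\theta_i$ is a local minimum of $g$ and $s_i=-$ if it is a local maximum; $\sigma=\varnothing$ if $g$ has no zeros; $\sigma=\infty$ if $g\equiv0$. Cyclic permutations of a list are regarded as the same list. Equilibria on the invariant circle are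 hyperbolic if and only if they correspond to simple zeros of $g$. *)

(* Defs.v *)
From mathcomp Require Export all_boot all_order all_algebra.
From mathcomp Require Export all_classical all_reals all_analysis.
From mathcomp Require Export complex.
Export Order.TTheory GRing.Theory Num.Theory.
Export numFieldNormedType.Exports.

Set Implicit Arguments.
Unset Strict Implicit.
Unset Printing Implicit Defensive.

Local Open Scope classical_set_scope.
Local Open Scope ring_scope.

(* Points of the plane are row vectors, with x = X 0 0 and y = X 0 1. *)
Definition vec2 {R : realType} (x y : R) : 'rV[R]_2 :=
  \row_(i < 2) (if i == 0 then x else y).

Definition dot {R : realType} (X Y : 'rV[R]_2) : R :=
  \sum_(i < 2) X 0 i * Y 0 i.

(* The norm `|X| that MathComp-Analysis puts on 'rV[R]_2 is the sup norm;
   unit vectors below are taken for the Euclidean norm. *)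
Definition enorm {R : realType} (X : 'rV[R]_2) : R := Num.sqrt (dot X X).

Definition contracting {R : realType} (Q : 'rV[R]_2 -> 'rV[R]_2) : Prop :=
  forall X : 'rV[R]_2, enorm X = 1 -> dot X (Q X) < 0.

Definition cubic_field {R : realType} (a10 a11 a20 a21 : R)
    (X : 'rV[R]_2) : 'rV[R]_2 :=
  let x := X 0 0 in
  let y := X 0 1 in
  vec2 (- x * (a10 * x ^+ 2 + a11 * y ^+ 2))
       (- y * (a20 * x ^+ 2 + a21 * y ^+ 2)).

Definition full_field {R : realType} (lambda : R)
    (Q : 'rV[R]_2 -> 'rV[R]_2) (X : 'rV[R]_2) : 'rV[R]_2 :=
  lambda *: X + Q X.

Definition perp {R : realType} (X : 'rV[R]_2) : 'rV[R]_2 :=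
  vec2 (- X 0 1) (X 0 0).

Definition LQ {R : realType} (Q : 'rV[R]_2 -> 'rV[R]_2) (X : 'rV[R]_2) : R :=
  dot (perp X) (Q X).

Definition phase {R : realType} (Q : 'rV[R]_2 -> 'rV[R]_2) (theta : R) : R :=
  LQ Q (vec2 (cos theta) (sin theta)).

Definition zero_multiplicity {R : realType} (g : R -> R) (t : R) (m : nat)
    : Prop :=
  [/\ (0 < m)%N, forall k, (k < m)%N -> derive1n k g t = 0
    & derive1n m g t != 0].

Definition increasing_around {R : realType} (g : R -> R) (t : R) : Prop :=
  exists2 e : R, 0 < e &
    forall u v : R, t - e < u -> u < v -> v < t + e -> g u < g v.

Definition decreasing_around {R : realType} (g : R -> R) (t : R) : Prop :=
  exists2 e : R, 0 < e &
    forall u v : R, t - e < u -> u < v -> v < t + e -> g v < g u.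

Definition local_minimum {R : realType} (g : R -> R) (t : R) : Prop :=
  \forall u \near t, g t <= g u.

Definition local_maximum {R : realType} (g : R -> R) (t : R) : Prop :=
  \forall u \near t, g u <= g t.

Inductive sign := Plus | Minus.

(* A symbol (j s): j is 1 or 2, s is the sign. *)
Definition symbol := (nat * sign)%type.

Definition symbol_at {R : realType} (g : R -> R) (t : R) (a : symbol) : Prop :=
  exists2 m : nat, zero_multiplicity g t m &
    if odd m then
      a.1 = 1%N /\
      match a.2 with
      | Plus => increasing_around g t
      | Minus => decreasing_around g t
      end
    else
      a.1 = 2%N /\
      match a.2 with
      | Plus => local_minimum g t
      | Minus => local_maximum g t
      end.

(* [SigmaSeq [::]] is the symbol sequence of a field without zeros. *)
Inductive symbol_sequence := SigmaInfty | SigmaSeq of seq symbol.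

(* [sigma_is g s] says that s is the symbol sequence of g.  A list is matched
   up to cyclic permutation, the i-th zero in [0, pi[ carrying the i-th symbol
   of some rotation of it.  The default values of nth are irrelevant. *)
Definition sigma_is {R : realType} (g : R -> R) (s : symbol_sequence) : Prop :=
  match s with
  | SigmaInfty => forall t : R, g t = 0
  | SigmaSeq l =>
      exists (thetas : seq R) (k : nat),
        [/\ sorted <%R thetas,
            forall t : R, t \in thetas = [&& 0 <= t, t < pi & g t == 0],
            size thetas = size l
          & forall i, (i < size thetas)%N ->
              symbol_at g (nth 0 thetas i) (nth (1%N, Plus) (rot k l) i)]
  end.

Definition trajectory {R : realType} (F : 'rV[R]_2 -> 'rV[R]_2) (I : set R)
    (phi : R -> 'rV[R]_2) : Prop :=
  forall t : R, I t -> is_derive t (1 : R) phi (F (phi t)).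

(* An injective continuous map on the compact unit circle is a homeomorphism
   onto its image. *)
Definition topological_circle {R : realType} (C : set 'rV[R]_2) : Prop :=
  let S := [set X : 'rV[R]_2 | enorm X = 1] in
  exists c : 'rV[R]_2 -> 'rV[R]_2,
    [/\ {within S, continuous c}, set_inj S c & c @` S = C].

Definition flow_invariant {R : realType} (F : 'rV[R]_2 -> 'rV[R]_2)
    (C : set 'rV[R]_2) : Prop :=
  forall X, C X -> exists phi : R -> 'rV[R]_2,
    [/\ phi 0 = X, trajectory F setT phi & forall t, C (phi t)].

Definition surrounds_origin {R : realType} (C : set 'rV[R]_2) : Prop :=
  bounded_set (connected_component (~` C) (0 : 'rV[R]_2)).

(* Forward trajectories starting at time 0 are taken on an open interval
   ]a, +oo[ with a < 0, so that a two-sided derivative makes sense at 0. *)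
Definition attracts_nonzero {R : realType} (F : 'rV[R]_2 -> 'rV[R]_2)
    (C : set 'rV[R]_2) : Prop :=
  forall (a : R) (phi : R -> 'rV[R]_2), a < 0 ->
    trajectory F [set t | a < t] phi -> phi 0 != 0 ->
    forall e : R, 0 < e ->
      \forall t \near +oo, exists2 Y, C Y & `|phi t - Y| < e.

Definition invariant_circle {R : realType} (F : 'rV[R]_2 -> 'rV[R]_2)
    (C : set 'rV[R]_2) : Prop :=
  [/\ topological_circle C, ~ C 0, flow_invariant F C, surrounds_origin C
    & attracts_nonzero F C].

Definition equilibrium {R : realType} (F : 'rV[R]_2 -> 'rV[R]_2)
    (X : 'rV[R]_2) : Prop :=
  F X = 0.

(* [jacobian] acts on row vectors, hence is the transpose of the usual
   Jacobian matrix; the spectrum is the same. *)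
Definition hyperbolic {R : realType} (F : 'rV[R]_2 -> 'rV[R]_2)
    (X : 'rV[R]_2) : Prop :=
  forall z : R[i],
    eigenvalue (map_mx (real_complex R) (jacobian F X)) z ->
    complex.Re z != 0.

(* Main.v *)
Require Import Defs.
From mathcomp Require Import ring lra.

(* The phase function is A cos^3 sin - B cos sin^3, whose derivatives are
   trigonometric quartics; its zeros in [0, pi[ are 0, pi/2 and, when A B > 0,
   the two angles with cos^2 = B / (A + B).  At a nonzero equilibrium X the
   Jacobian of the field has the radial eigenvalue -2 lambda (Euler's identity
   for the cubic part), and a second real eigenvalue read off the trace: A x^2
   or B y^2 on an axis, and -2 B y^2 off the axes, where A x^2 = B y^2.
   Which equilibria lie on an invariant circle C needs no flow theory: a
   constant trajectory is attracted by C, and C is closed as a compact image,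
   so C contains every nonzero equilibrium. *)

Set Implicit Arguments.
Unset Strict Implicit.
Unset Printing Implicit Defensive.

Local Open Scope classical_set_scope.
Local Open Scope ring_scope.

(** * Plane vectors, Jacobians and eigenvalues of 2 by 2 matrices *)

Lemma vec2E0 (R : realType) (x y : R) : vec2 x y 0 0 = x.
Proof. by rewrite mxE. Qed.

Lemma vec2E1 (R : realType) (x y : R) : vec2 x y 0 1 = y.
Proof. by rewrite mxE. Qed.

Lemma rV2P (R : realType) (X Y : 'rV[R]_2) :
  X 0 0 = Y 0 0 -> X 0 1 = Y 0 1 -> X = Y.
Proof.
move=> e0 e1; apply/rowP => j; case: j => -[|[|//]] lt2.
- by rewrite (_ : Ordinal lt2 = 0) //; apply/val_inj.
- by rewrite (_ : Ordinal lt2 = 1) //; apply/val_inj.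
Qed.

Lemma ord2P (i : 'I_2) : i = 0 \/ i = 1.
Proof. by case: i => -[|[|//]] ?; [left|right]; apply/val_inj. Qed.

Lemma dotE (R : realType) (X Y : 'rV[R]_2) :
  dot X Y = X 0 0 * Y 0 0 + X 0 1 * Y 0 1.
Proof.
by rewrite /dot big_ord_recl big_ord1 (_ : lift _ _ = 1)//; exact/val_inj.
Qed.

Lemma det2E (R : comNzRingType) (M : 'M[R]_2) :
  \det M = M 0 0 * M 1 1 - M 0 1 * M 1 0.
Proof.
rewrite (expand_det_row _ 0) big_ord_recl big_ord1 /cofactor !det_mx11 !mxE /=.
rewrite !(expr0, expr1, mul1r, mulN1r, mulrN) /=.
congr (_ * M _ _ - M _ _ * M _ _); exact/val_inj.
Qed.

Lemma eigenvalue2E (F : fieldType) (M : 'M[F]_2) (z : F) :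
  eigenvalue M z = (z ^+ 2 - (M 0 0 + M 1 1) * z + \det M == 0).
Proof.
rewrite eigenvalue_root_char /root /char_poly !det2E !mxE /=.
rewrite !hornerE /=; congr (_ == _); ring.
Qed.

Lemma is_derive_coord (R : realFieldType) m n (i : 'I_m) (j : 'I_n)
    (X V : 'M[R]_(m, n)) :
  is_derive X V (fun N : 'M[R]_(m, n) => N i j) (V i j).
Proof.
have d := differentiable_coord X i j.
split; first exact: diff_derivable.
(* The coordinate packaged as a linear map: being continuous, it is its own differential. *)
have @f : {linear 'M[R]_(m, n) -> R}.
  by exists (fun N : 'M[R]_(_, _) => N i j); do 2![eexists]; do ?[constructor];
     rewrite ?mxE// => ? *; rewrite ?mxE//; move=> ?; rewrite !mxE.
rewrite deriveE //.
rewrite (_ : (fun _ => _) = f) // diff_lin//.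
exact: coord_continuous.
Qed.

Lemma differentiable_rV2 (R : realType) (f : 'rV[R]_2 -> 'rV[R]_2) X :
  differentiable (fun Y => f Y 0 0) X -> differentiable (fun Y => f Y 0 1) X ->
  differentiable f X.
Proof.
move=> d0 d1.
rewrite (_ : f = (fun Y => f Y 0 0 *: delta_mx 0 0) +
                 (fun Y => f Y 0 1 *: delta_mx 0 1)); last first.
  by apply/funext => Y; apply: rV2P; rewrite !mxE /= ?mulr1 ?mulr0 ?addr0 ?add0r.
by apply: differentiableD; apply: differentiableZl.
Qed.

Lemma jacobianE (R : realType) (f : 'rV[R]_2 -> 'rV[R]_2) X (i j : 'I_2) :
  differentiable f X ->
  jacobian f X i j = 'D_(delta_mx 0 i) (fun Y => f Y 0 j) X.
Proof.
move=> df; transitivity (row i (jacobian f X) 0 j); first by rewrite [RHS]mxE.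
rewrite rowE -deriveEjacobian// derive_mx; last exact/diff_derivable.
by rewrite mxE.
Qed.

(** The trace and determinant make the characteristic polynomial factor as (z - p)(z - q) over the
    complex numbers, so every eigenvalue is one of two nonzero reals. *)
Lemma hyperbolic_eigenvalues (R : realType) (f : 'rV[R]_2 -> 'rV[R]_2) X (p q : R) :
  p != 0 -> q != 0 -> jacobian f X 0 0 + jacobian f X 1 1 = p + q ->
  \det (jacobian f X) = p * q -> hyperbolic f X.
Proof.
rewrite /hyperbolic; move: (jacobian f X) => J p0 q0 trJ detJ z.
rewrite eigenvalue2E det_map_mx 2!mxE -rmorphD /= trJ detJ.
rewrite rmorphD rmorphM /=.
rewrite (_ : _ + _ = (z - p%:C%C) * (z - q%:C%C)); last by ring.
by rewrite mulf_eq0 !subr_eq0 => /orP[] /eqP ->.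
Qed.

Lemma det0_not_hyperbolic (R : realType) (f : 'rV[R]_2 -> 'rV[R]_2) X :
  \det (jacobian f X) = 0 -> ~ hyperbolic f X.
Proof.
rewrite /hyperbolic; move: (jacobian f X) => J detJ /(_ 0); rewrite eigenvalue2E det_map_mx detJ.
by rewrite rmorph0 mulr0 expr0n subrr addr0 /= !eqxx => /(_ isT).
Qed.

(** * Hyperbolicity of the equilibria of the planar field *)

Section Field.
Context {R : realType}.
Variables lambda a10 a11 a20 a21 : R.
Local Notation F := (full_field lambda (cubic_field a10 a11 a20 a21)).

Lemma full_fieldE X : F X =
  vec2 (X 0 0 * (lambda - a10 * X 0 0 ^+ 2 - a11 * X 0 1 ^+ 2))
       (X 0 1 * (lambda - a20 * X 0 0 ^+ 2 - a21 * X 0 1 ^+ 2)).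
Proof. by apply: rV2P; rewrite !mxE /=; ring. Qed.

(** Naming the coordinates as functions turns the components of the field into polynomials in the
    ring of functions, the form to which the derivation rules apply. *)
Let xc (X : 'rV[R]_2) := X 0 0.
Let yc (X : 'rV[R]_2) := X 0 1.

Let full_field0E :
  (fun X => F X 0 0) = xc * (cst lambda - a10 *: xc ^+ 2 - a11 *: yc ^+ 2).
Proof. by apply/funext => X; rewrite full_fieldE vec2E0. Qed.

Let full_field1E :
  (fun X => F X 0 1) = yc * (cst lambda - a20 *: xc ^+ 2 - a21 *: yc ^+ 2).
Proof. by apply/funext => X; rewrite full_fieldE vec2E1. Qed.

Lemma differentiable_full_field X : differentiable F X.
Proof.
have dx : differentiable xc X by exact: differentiable_coord.
have dy : differentiable yc X by exact: differentiable_coord.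
have dg b c : differentiable (cst lambda - b *: xc ^+ 2 - c *: yc ^+ 2) X.
  have d0 := differentiable_cst lambda X.
  have dx2 := differentiableZ b (@differentiableX _ _ _ 1 _ dx).
  have dy2 := differentiableZ c (@differentiableX _ _ _ 1 _ dy).
  exact: differentiableB (differentiableB d0 dx2) dy2.
apply: differentiable_rV2; rewrite ?full_field0E ?full_field1E.
  exact: differentiableM dx (dg a10 a11).
exact: differentiableM dy (dg a20 a21).
Qed.

Lemma jacobian_full_field X :
  [/\ jacobian F X 0 0 = lambda - 3 * a10 * X 0 0 ^+ 2 - a11 * X 0 1 ^+ 2,
      jacobian F X 0 1 = - 2 * a20 * X 0 0 * X 0 1,
      jacobian F X 1 0 = - 2 * a11 * X 0 0 * X 0 1
    & jacobian F X 1 1 = lambda - a20 * X 0 0 ^+ 2 - 3 * a21 * X 0 1 ^+ 2].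
Proof.
have dF := differentiable_full_field X.
have dx V : is_derive X V xc (V 0 0) by exact: is_derive_coord.
have dy V : is_derive X V yc (V 0 1) by exact: is_derive_coord.
rewrite -/(xc X) -/(yc X).
split; rewrite jacobianE// ?full_field0E ?full_field1E derive_val.
all: rewrite !mxE /= !fctE /= /GRing.scale /=; ring.
Qed.

(** Each axis asks only for the coefficient in its own transverse eigenvalue. Off the axes one
    nonzero coefficient suffices, since A x^2 = B y^2 then makes both nonzero. This form also serves
    the degenerate case, where exactly one of A and B vanishes. *)
Lemma full_field_hyperbolic X : X != 0 -> equilibrium F X -> 0 < lambda ->
  a10 - a20 != 0 \/ a21 - a11 != 0 ->
  (X 0 0 = 0 -> a21 - a11 != 0) -> (X 0 1 = 0 -> a10 - a20 != 0) ->
  hyperbolic F X.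
Proof.
rewrite /equilibrium full_fieldE.
set A := a10 - a20; set B := a21 - a11 => X0 FX0 l0 AB hB hA.
have [J00 J01 J10 J11] := jacobian_full_field X.
have := congr1 (fun Z : 'rV[R]_2 => Z 0 0) FX0.
have := congr1 (fun Z : 'rV[R]_2 => Z 0 1) FX0.
rewrite /= vec2E0 vec2E1 !mxE => {FX0}.
move: (@rV2P _ X 0); rewrite !mxE.
move: J00 J01 J10 J11 hB hA.
set x := X 0 0; set y := X 0 1 => J00 J01 J10 J11 hB hA XN eqy eqx.
have l2 : - 2 * lambda != 0 by rewrite mulf_neq0// ?gt_eqF// lt_eqF// oppr_lt0.
have xy : x != 0 \/ y != 0.
  have [x0|] := eqVneq x 0; last by left.
  have [y0|] := eqVneq y 0; last by right.
  by rewrite (XN x0 y0) eqxx in X0.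
have [x0|x0] := eqVneq x 0.
  have y0 : y != 0 by case: xy => //; rewrite x0 eqxx.
  have {}eqy : lambda = a21 * y ^+ 2.
    apply: (mulfI y0); apply/eqP; rewrite -subr_eq0; apply/eqP; rewrite -eqy x0.
    ring.
  refine (@hyperbolic_eigenvalues _ _ _ (- 2 * lambda) (B * y ^+ 2) _ _ _ _) => //.
  - by rewrite mulf_neq0 ?hB// expf_neq0.
  - by rewrite J00 J11 x0 eqy /B; ring.
  - by rewrite det2E J00 J11 J01 J10 x0 eqy /B; ring.
have {}eqx : lambda = a10 * x ^+ 2 + a11 * y ^+ 2.
  by apply: (mulfI x0); apply/eqP; rewrite -subr_eq0; apply/eqP; rewrite -eqx; ring.
have [y0|y0] := eqVneq y 0.
  refine (@hyperbolic_eigenvalues _ _ _ (- 2 * lambda) (A * x ^+ 2) _ _ _ _) => //.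
  - by rewrite mulf_neq0 ?hA// expf_neq0.
  - by rewrite J00 J11 y0 eqx y0 /A; ring.
  - by rewrite det2E J00 J11 J01 J10 y0 eqx y0 /A; ring.
have {}eqy : lambda = a20 * x ^+ 2 + a21 * y ^+ 2.
  by apply: (mulfI y0); apply/eqP; rewrite -subr_eq0; apply/eqP; rewrite -eqy; ring.
have ABxy : A * x ^+ 2 = B * y ^+ 2.
  apply/eqP; rewrite -subr_eq0; apply/eqP.
  by rewrite -(subrr lambda) {1}eqx eqy /A /B; ring.
have B0 : B != 0.
  case: AB => // A0; apply/eqP => B0; move/eqP: ABxy; rewrite B0 mul0r.
  by rewrite mulf_eq0 (negbTE A0) sqrf_eq0 (negbTE x0).
have tr0 : lambda - 3 * a10 * x ^+ 2 - a11 * y ^+ 2 = - 2 * a10 * x ^+ 2.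
  by rewrite eqx; ring.
have tr1 : lambda - a20 * x ^+ 2 - 3 * a21 * y ^+ 2 = - 2 * a21 * y ^+ 2.
  by rewrite eqy; ring.
refine (@hyperbolic_eigenvalues _ _ _ (- 2 * lambda) (- 2 * B * y ^+ 2) _ _ _ _) => //.
- by rewrite !mulf_neq0// ?sqrf_eq0// oppr_eq0 pnatr_eq0.
- by rewrite J00 J11 tr0 tr1 {}eqx /B; ring.
- rewrite det2E J00 J11 J01 J10 tr0 tr1.
  (* The determinant is 4 x^2 y^2 (a10 a21 - a11 a20) and must equal 4 lambda B y^2; the identity
     follows on replacing B y^2 by A x^2. *)
  have : B * lambda = x ^+ 2 * (a10 * a21 - a11 * a20).
    rewrite eqx mulrDr [B * (a11 * _)]mulrCA -ABxy /A /B; ring.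
  move=> h; transitivity (4 * (B * lambda) * y ^+ 2); last by ring.
  by rewrite h; ring.
Qed.

Lemma axis0_equilibrium (X : 'rV[R]_2) : X 0 1 = 0 -> X 0 0 != 0 ->
  equilibrium F X <-> lambda = a10 * X 0 0 ^+ 2.
Proof.
move=> X1 X0; rewrite /equilibrium full_fieldE X1; split => [/rowP/(_ 0)|->].
  rewrite vec2E0 mxE => /eqP; rewrite mulf_eq0 (negbTE X0) /= => /eqP; lra.
by apply: rV2P; rewrite !mxE /=; ring.
Qed.

Lemma axis1_equilibrium (X : 'rV[R]_2) : X 0 0 = 0 -> X 0 1 != 0 ->
  equilibrium F X <-> lambda = a21 * X 0 1 ^+ 2.
Proof.
move=> X0 X1; rewrite /equilibrium full_fieldE X0; split => [/rowP/(_ 1)|->].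
  rewrite vec2E1 mxE => /eqP; rewrite mulf_eq0 (negbTE X1) /= => /eqP; lra.
by apply: rV2P; rewrite !mxE /=; ring.
Qed.

(** On the axis the Jacobian is diagonal, and its transverse entry lambda - a20 x^2 is zero by the
    equilibrium equation once a10 = a20. *)
Lemma axis0_not_hyperbolic (X : 'rV[R]_2) :
  a10 = a20 -> X 0 1 = 0 -> lambda = a10 * X 0 0 ^+ 2 -> ~ hyperbolic F X.
Proof.
move=> aE X1 lE; apply: det0_not_hyperbolic.
have [J00 J01 J10 J11] := jacobian_full_field X.
by rewrite det2E J00 J01 J10 J11 X1 lE aE; ring.
Qed.

Lemma axis1_not_hyperbolic (X : 'rV[R]_2) :
  a11 = a21 -> X 0 0 = 0 -> lambda = a21 * X 0 1 ^+ 2 -> ~ hyperbolic F X.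
Proof.
move=> aE X0 lE; apply: det0_not_hyperbolic.
have [J00 J01 J10 J11] := jacobian_full_field X.
by rewrite det2E J00 J01 J10 J11 X0 lE aE; ring.
Qed.

End Field.

(** * Compactness of the unit circle and equilibria on an invariant circle *)

Lemma sqr_enorm (R : realType) (X : 'rV[R]_2) :
  enorm X ^+ 2 = X 0 0 ^+ 2 + X 0 1 ^+ 2.
Proof.
by rewrite /enorm dotE sqr_sqrtr -!expr2// addr_ge0// sqr_ge0.
Qed.

(** Without the square root the circle is the preimage of a point under a polynomial map, hence
    visibly closed. *)
Lemma unit_circleE (R : realType) :
  [set X : 'rV[R]_2 | enorm X = 1] =
  [set X : 'rV[R]_2 | X 0 0 ^+ 2 + X 0 1 ^+ 2 = 1].
Proof.
apply/seteqP; split => X /=; first by move=> e; rewrite -sqr_enorm e expr1n.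
rewrite -sqr_enorm => /eqP; rewrite sqrf_eq1 => /orP[/eqP//|/eqP e].
by have : 0 <= enorm X := sqrtr_ge0 _; rewrite e oppr_ge0 ler10.
Qed.

Lemma compact_unit_circle (R : realType) :
  compact [set X : 'rV[R]_2 | enorm X = 1].
Proof.
rewrite unit_circleE; apply: bounded_closed_compact.
  exists 1; split; first exact: num_real.
  move=> M M1 X /= e.
  rewrite [`|X|]mx_normrE.
  apply: bigmax_le => /=; first exact: ltW (lt_trans ltr01 M1).
  move=> [i j] _ /=; apply: le_trans (ltW M1).
  rewrite -(@expr_le1 _ 2)// real_normK ?num_real// -e (ord1 i).
  by case: (ord2P j) => ->; rewrite ?lerDl ?lerDr sqr_ge0.
have cX (j : 'I_2) : continuous (fun X : 'rV[R]_2 => X 0 j ^+ 2).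
  move=> X; apply: (@continuous_comp _ _ _ (fun X : 'rV[R]_2 => X 0 j) (fun z => z ^+ 2)).
    exact: coord_continuous.
  exact: exprn_continuous.
apply: (@preimage_closed _ _ (fun X : 'rV[R]_2 => X 0 0 ^+ 2 + X 0 1 ^+ 2) [set 1]).
  by move=> X _; exact: (cvgD (cX 0 X) (cX 1 X)).
exact: closed_eq.
Qed.

Lemma topological_circle_closed (R : realType) (C : set 'rV[R]_2) :
  topological_circle C -> closed C.
Proof.
move=> [c [cC _ <-]]; apply: compact_closed; first exact: norm_hausdorff.
by apply: continuous_compact => //; exact: compact_unit_circle.
Qed.

Lemma equilibrium_in_invariant_circle (R : realType)
    (F : 'rV[R]_2 -> 'rV[R]_2) (C : set 'rV[R]_2) X :
  invariant_circle F C -> equilibrium F X -> X != 0 -> C X.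
Proof.
move=> [/topological_circle_closed clC _ _ _ attr] FX X0.
rewrite ((closure_id C).1 clC) => U /nbhs_ballP[e /= e0 eU].
have trX : trajectory F [set t | -1 < t] (cst X).
  by move=> t _; rewrite FX; exact: is_derive_cst.
have [M [_ nearM]] := attr _ _ (ltrN10 R) trX X0 e e0.
(* At any late time the constant trajectory is still at X, so C meets the ball of radius e around
   X. *)
have [//|Y CY XY] := nearM (M + 1); first by rewrite ltrDl.
by exists Y; split => //; apply: eU; rewrite -ball_normE.
Qed.

(** * Symbols at zeros of odd multiplicity, from the sign of the derivative *)

Lemma increasing_around_derive (R : realType) (g g' : R -> R) (t : R) :
  (forall u : R, is_derive u 1 g (g' u)) -> (\forall u \near t^', 0 < g' u) ->
  increasing_around g t.
Proof.
move=> dg /nbhs_ballP[e /= e0 g'_gt0]; exists e => // u v tu uv vt.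
(* The derivative may vanish at t, so the mean value theorem is applied only to intervals without t
   in their interior; an interval straddling t is cut there. *)
have lt_piece x y : t - e < x -> x < y -> y < t + e -> (y <= t) || (t <= x) ->
    g x < g y.
  move=> tx xy yt side.
  have [|z] := MVT xy (fun z _ => dg z).
    apply: derivable_within_continuous => z _; exact: ex_derive.
  rewrite in_itv /= => /andP[xz zy] gE; rewrite -subr_gt0 gE.
  rewrite mulr_gt0 ?subr_gt0//; apply: g'_gt0.
    rewrite /ball /= ltr_distlC; apply/andP; split; lra.
  by apply/eqP => zt; case/orP: side; lra.
have [vt'|tv] := leP v t; first by apply: lt_piece; rewrite ?vt'.
have [tu'|ut] := leP t u; first by apply: lt_piece; rewrite ?tu' ?orbT.
apply: (@lt_trans _ _ (g t)); apply: lt_piece; rewrite ?lexx ?orbT//; lra.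
Qed.

Lemma decreasing_around_derive (R : realType) (g g' : R -> R) (t : R) :
  (forall u : R, is_derive u 1 g (g' u)) -> (\forall u \near t^', g' u < 0) ->
  decreasing_around g t.
Proof.
move=> dg g'_lt0.
have dNg (u : R) : is_derive u 1 (- g) ((- g') u) by exact: is_deriveN.
have Ng'_gt0 : \forall u \near t^', 0 < (- g') u.
  by near=> u; rewrite fctE oppr_gt0; near: u.
have [e e0 inc] := increasing_around_derive dNg Ng'_gt0.
by exists e => // u v tu uv vt; rewrite -ltrN2; exact: inc.
Unshelve. all: by end_near. Qed.

(** Reading the sign off a coefficient treats both orientations at once. It is applied to nonzero k;
    the value at 0 is a convention. *)
Definition sign_of {R : realType} (k : R) : sign := if 0 < k then Plus else Minus.

Lemma symbol_at_odd (R : realType) (g g' : R -> R) (t k : R) (m : nat) :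
  zero_multiplicity g t m -> odd m -> k != 0 ->
  (forall u : R, is_derive u 1 g (g' u)) -> (\forall u \near t^', 0 < k * g' u) ->
  symbol_at g t (1%N, sign_of k).
Proof.
move=> mult m_odd k0 dg kg'; exists m => //; rewrite m_odd; split => //=.
rewrite /sign_of; case: ltgtP k0 => // k0 _.
  apply: increasing_around_derive dg _.
  by near=> u; rewrite -(pmulr_rgt0 _ k0); near: u.
apply: decreasing_around_derive dg _.
by near=> u; rewrite -(nmulr_rgt0 _ k0); near: u.
Unshelve. all: by end_near. Qed.

(** * Trigonometric quartics: derivatives, zeros and symbols *)

Section Trigonometric.
Context {R : realType}.
Implicit Types a b t u : R.

(** The phase function, with a = A and b = -B. Odd and even refer to parity in t; differentiation
    exchanges the two families, which gives every derivative in closed form. *)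
Definition odd_quartic a b t := a * (cos t ^+ 3 * sin t) + b * (cos t * sin t ^+ 3).

Definition even_quartic a b t :=
  a * cos t ^+ 4 + 3 * (b - a) * (cos t ^+ 2 * sin t ^+ 2) - b * sin t ^+ 4.

Lemma is_derive_odd_quartic a b t :
  is_derive t 1 (odd_quartic a b) (even_quartic a b t).
Proof.
have dc := is_derive_cos t; have ds := is_derive_sin t.
have d31 := is_deriveM (is_deriveX 3 dc) ds.
have d13 := is_deriveM dc (is_deriveX 3 ds).
have -> : odd_quartic a b = a *: (cos ^+ 3 * sin) + b *: (cos * sin ^+ 3).
  by apply/funext.
apply: is_derive_eq (is_deriveD (is_deriveZ a d31) (is_deriveZ b d13)) _.
rewrite /even_quartic !fctE /GRing.scale /=; ring.
Qed.

Lemma is_derive_even_quartic a b t :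
  is_derive t 1 (even_quartic a b) (odd_quartic (6 * b - 10 * a) (6 * a - 10 * b) t).
Proof.
have dc := is_derive_cos t; have ds := is_derive_sin t.
have d22 := is_deriveM (is_deriveX 2 dc) (is_deriveX 2 ds).
have -> : even_quartic a b =
    a *: cos ^+ 4 + (3 * (b - a)) *: (cos ^+ 2 * sin ^+ 2) - b *: sin ^+ 4.
  by apply/funext.
apply: is_derive_eq (is_deriveB (is_deriveD (is_deriveZ a (is_deriveX 4 dc))
  (is_deriveZ (3 * (b - a)) d22)) (is_deriveZ b (is_deriveX 4 ds))) _.
rewrite /odd_quartic !fctE /GRing.scale /=; ring.
Qed.

Lemma derive1_odd_quartic a b : (odd_quartic a b)^`()%classic = even_quartic a b.
Proof.
apply/funext => t; rewrite derive1E.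
exact: (@derive_val _ _ _ _ _ _ _ (is_derive_odd_quartic a b t)).
Qed.

Lemma derive1_even_quartic a b : (even_quartic a b)^`()%classic =
  odd_quartic (6 * b - 10 * a) (6 * a - 10 * b).
Proof.
apply/funext => t; rewrite derive1E.
exact: (@derive_val _ _ _ _ _ _ _ (is_derive_even_quartic a b t)).
Qed.

Lemma continuous_even_quartic a b : continuous (even_quartic a b).
Proof.
move=> t; apply: differentiable_continuous; apply/derivable1_diffP.
by have [] := is_derive_even_quartic a b t.
Qed.

Lemma symbol_at_simple a b t : odd_quartic a b t = 0 -> even_quartic a b t != 0 ->
  symbol_at (odd_quartic a b) t (1%N, sign_of (even_quartic a b t)).
Proof.
move=> g0 g'0; set k := even_quartic a b t.
apply: (@symbol_at_odd _ _ (even_quartic a b) _ _ 1%N) => //.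
- by split => //; [case|rewrite derive1n1 derive1_odd_quartic].
- exact: is_derive_odd_quartic.
apply: nbhs_dnbhs.
(* The limit k^2 is positive, so the derivative keeps the sign of k near t. *)
have : k * even_quartic a b u @[u --> t] --> k * k.
  by apply: cvgM; [exact: cvg_cst|exact: continuous_even_quartic].
move/cvgr_gt; apply; by rewrite -expr2 exprn_even_gt0.
Qed.

Lemma sin_eq0_itv t : 0 <= t < pi -> (sin t == 0) = (t == 0).
Proof.
move=> /andP[t0 tpi]; have [->|tN0] := eqVneq t 0; first by rewrite sin0 eqxx.
by apply/negbTE; rewrite gt_eqF// sin_gt0_pi// tpi lt_neqAle eq_sym tN0 t0.
Qed.

Lemma pihalf_itv : ((0 : R) < pi / 2) && (pi / 2 < pi :> R).
Proof. have := @pi_gt0 R; lra. Qed.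

Lemma cos_eq_itv t u : 0 <= t < pi -> 0 <= u < pi -> (cos t == cos u) = (t == u).
Proof.
move=> /andP[t0 tpi] /andP[u0 upi]; apply/eqP/eqP => [|->//].
by apply: cos_inj; rewrite in_itv /= ?t0 ?u0 ltW.
Qed.

Lemma cos_eq0_itv t : 0 <= t < pi -> (cos t == 0) = (t == pi / 2).
Proof.
move=> tpi; rewrite -cos_pihalf cos_eq_itv//; have := pihalf_itv; lra.
Qed.

(** This separates the zeros on the axes from those of a quadratic form in cos t and sin t, whose
    definiteness distinguishes the cases. *)
Lemma odd_quarticE a b t :
  odd_quartic a b t = cos t * sin t * (a * cos t ^+ 2 + b * sin t ^+ 2).
Proof. by rewrite /odd_quartic; ring. Qed.

Lemma odd_quartic_eq0_itv a b t : 0 <= t < pi ->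
  (odd_quartic a b t == 0) =
  [|| t == 0, t == pi / 2 | a * cos t ^+ 2 + b * sin t ^+ 2 == 0].
Proof.
move=> tpi; rewrite odd_quarticE !mulf_eq0 sin_eq0_itv// cos_eq0_itv//.
by rewrite [(t == pi / 2) || _]orbC orbA.
Qed.

Lemma odd_quartic0 a b : odd_quartic a b 0 = 0.
Proof. by rewrite odd_quarticE sin0 mulr0 mul0r. Qed.

Lemma odd_quartic_pihalf a b : odd_quartic a b (pi / 2) = 0.
Proof. by rewrite odd_quarticE cos_pihalf !mul0r. Qed.

Lemma even_quartic0 a b : even_quartic a b 0 = a.
Proof. by rewrite /even_quartic sin0 cos0; ring. Qed.

Lemma even_quartic_pihalf a b : even_quartic a b (pi / 2) = - b.
Proof. by rewrite /even_quartic sin_pihalf cos_pihalf; ring. Qed.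

Lemma symbol_at_0 a b : a != 0 -> symbol_at (odd_quartic a b) 0 (1%N, sign_of a).
Proof.
by have := @symbol_at_simple a b 0; rewrite even_quartic0 odd_quartic0; apply.
Qed.

Lemma symbol_at_pihalf a b : b != 0 ->
  symbol_at (odd_quartic a b) (pi / 2) (1%N, sign_of (- b)).
Proof.
rewrite -oppr_eq0; have := @symbol_at_simple a b (pi / 2).
by rewrite even_quartic_pihalf odd_quartic_pihalf; apply.
Qed.

(** The table stops at the third derivative, which is what a triple zero requires. *)
Lemma derive1n_odd_quartic a b k : (k < 4)%N -> (odd_quartic a b)^`(k)%classic =
  nth (odd_quartic a b) [:: odd_quartic a b; even_quartic a b;
    odd_quartic (6 * b - 10 * a) (6 * a - 10 * b);
    even_quartic (6 * b - 10 * a) (6 * a - 10 * b)] k.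
Proof.
case: k => [|[|[|[|//]]]] _ /=;
  by rewrite ?derive1nS ?derive1n0 ?(derive1_odd_quartic, derive1_even_quartic).
Qed.

Lemma near_sin_neq0 t : \forall u \near t^', sin (u - t) != 0.
Proof.
apply/nbhs_ballP; exists pi => /=; first exact: pi_gt0.
move=> u; rewrite /ball /= ltr_distlC => /andP[tu ut] u_neq_t.
have [ltut|] := ltP u t; last first.
  by rewrite le_eqVlt eq_sym (negbTE u_neq_t) /= => ltut; rewrite gt_eqF// sin_gt0_pi//; lra.
by rewrite -oppr_eq0 -sinN gt_eqF// sin_gt0_pi//; lra.
Qed.

(* At a triple zero the derivative vanishes only to second order, through the
   square of w, so it keeps the sign of k on both sides of t. *)
Lemma symbol_at_triple a b t k (w q : R -> R) :
  odd_quartic a b t = 0 -> even_quartic a b t = 0 ->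
  odd_quartic (6 * b - 10 * a) (6 * a - 10 * b) t = 0 ->
  even_quartic (6 * b - 10 * a) (6 * a - 10 * b) t != 0 ->
  k != 0 -> (forall u, k * even_quartic a b u = (k * w u) ^+ 2 * q u) ->
  (\forall u \near t^', w u != 0) -> {for t, continuous q} -> 0 < q t ->
  symbol_at (odd_quartic a b) t (1%N, sign_of k).
Proof.
move=> g0 g1 g2 g3 k0 kE w0 cq qt.
apply: (@symbol_at_odd _ _ (even_quartic a b) _ _ 3%N) => //.
- split => // [i i3|]; rewrite derive1n_odd_quartic//; last by apply: ltn_trans i3 _.
  by case: i i3 => [|[|[|//]]] _.
- exact: is_derive_odd_quartic.
near=> u; rewrite kE mulr_gt0//.
  by rewrite exprn_even_gt0//= mulf_neq0//; near: u.
near: u; apply: nbhs_dnbhs; move/cvgr_gt: cq; exact.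
Unshelve. all: by end_near. Qed.

Lemma continuous_cos_sin_form p q :
  continuous (fun t => p * cos t ^+ 2 + q * sin t ^+ 2 : R).
Proof.
have continuous_sqr (f : R -> R) : continuous f -> continuous (fun t => f t ^+ 2).
  move=> cf t; apply: (@continuous_comp _ _ _ f (fun z => z ^+ 2)).
    exact: cf.
  exact: exprn_continuous.
have cc := continuous_sqr _ (@continuous_cos R).
have cs := continuous_sqr _ (@continuous_sin R).
by move=> t; exact: (cvgD (cvgM (cvg_cst p) (cc t)) (cvgM (cvg_cst q) (cs t))).
Qed.

(** For a = 0 the derivative is b sin^2 (3 cos^2 - sin^2): the square of [sin] times a factor equal
    to 3 at 0. *)
Lemma symbol_at_0_triple b : b != 0 ->
  symbol_at (odd_quartic 0 b) 0 (1%N, sign_of b).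
Proof.
move=> b0; apply: (@symbol_at_triple _ _ _ _ sin
  (fun u => 3 * cos u ^+ 2 + (- 1) * sin u ^+ 2)) => //.
- exact: odd_quartic0.
- exact: even_quartic0.
- exact: odd_quartic0.
- by rewrite even_quartic0 mulr0 subr0 mulf_neq0// pnatr_eq0.
- by move=> u; rewrite /even_quartic; ring.
- by near=> u; rewrite -[u]subr0; near: u; exact: near_sin_neq0.
- exact: continuous_cos_sin_form.
- by rewrite sin0 cos0; lra.
Unshelve. all: by end_near. Qed.

(** For b = 0 the derivative is -a cos^2 (3 sin^2 - cos^2), whence the sign of -a and the choice of
    [cos] for the vanishing factor. *)
Lemma symbol_at_pihalf_triple a : a != 0 ->
  symbol_at (odd_quartic a 0) (pi / 2) (1%N, sign_of (- a)).
Proof.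
move=> a0; apply: (@symbol_at_triple _ _ _ _ cos
  (fun u => (- 1) * cos u ^+ 2 + 3 * sin u ^+ 2)) => //.
- exact: odd_quartic_pihalf.
- by rewrite even_quartic_pihalf oppr0.
- exact: odd_quartic_pihalf.
- by rewrite even_quartic_pihalf mulr0 subr0 oppr_eq0 mulf_neq0// pnatr_eq0.
- by rewrite oppr_eq0.
- by move=> u; rewrite /even_quartic; ring.
- by near=> u; rewrite -[cos u]opprK -sinBpihalf oppr_eq0; near: u; exact: near_sin_neq0.
- exact: continuous_cos_sin_form.
- by rewrite sin_pihalf cos_pihalf; lra.
Unshelve. all: by end_near. Qed.

(** * Symbol sequences of the quartics *)

Lemma sigma_two (g : R -> R) (k : R) : k != 0 ->
  (forall t, 0 <= t < pi -> (g t == 0) = (t == 0) || (t == pi / 2)) ->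
  symbol_at g 0 (1%N, sign_of k) ->
  symbol_at g (pi / 2) (1%N, sign_of (- k)) ->
  sigma_is g (SigmaSeq [:: (1%N, Plus); (1%N, Minus)]).
Proof.
move=> k0 gz s0 s1; have /andP[pi2_gt0 pi2_lt] := pihalf_itv.
(* If k < 0, the list read from the zero 0 starts with a minus. *)
exists [:: 0; pi / 2], (if 0 < k then 0%N else 1%N); split => //.
- by rewrite /= andbT.
- move=> t; rewrite !inE; apply/idP/idP => [|/and3P[t0 tpi]]; last first.
    by rewrite gz// t0.
  by case/orP => /eqP ->; rewrite gz ?eqxx ?orbT ?lexx ?pi_gt0 ?(ltW pi2_gt0) ?pi2_lt.
- move: s0 s1; rewrite /sign_of oppr_gt0.
  by case: ltgtP k0 => // _ _ s0 s1 [|[|]].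
Qed.

Lemma sigma_four (g : R -> R) (k t1 t3 : R) : k != 0 ->
  0 < t1 -> t1 < pi / 2 -> pi / 2 < t3 -> t3 < pi ->
  (forall t, 0 <= t < pi ->
    (g t == 0) = [|| t == 0, t == t1, t == pi / 2 | t == t3]) ->
  symbol_at g 0 (1%N, sign_of k) ->
  symbol_at g t1 (1%N, sign_of (- k)) ->
  symbol_at g (pi / 2) (1%N, sign_of k) ->
  symbol_at g t3 (1%N, sign_of (- k)) ->
  sigma_is g (SigmaSeq [:: (1%N, Plus); (1%N, Minus); (1%N, Plus); (1%N, Minus)]).
Proof.
move=> k0 t1_gt0 t1_lt t3_gt t3_lt gz s0 s1 s2 s3.
(* The alternating pattern has period two, so a rotation by one reverses every sign. *)
exists [:: 0; t1; pi / 2; t3], (if 0 < k then 0%N else 1%N); split => //.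
- by rewrite /= t1_gt0 t1_lt t3_gt.
- move=> t; rewrite !inE; apply/idP/idP => [h|/and3P[t0 tpi]]; last first.
    by rewrite gz// t0.
  have /andP[t0 tpi] : 0 <= t < pi.
    by case/or4P: h => /eqP ->; apply/andP; split; lra.
  by rewrite t0 tpi gz ?t0.
- move: s0 s1 s2 s3; rewrite /sign_of oppr_gt0.
  by case: ltgtP k0 => // _ _ s0 s1 s2 s3 [|[|[|[|]]]].
Qed.

(** Exactly one coefficient vanishes, and the quadratic factor is a multiple of sin^2 or cos^2: it
    adds no zero but makes one axis zero triple. *)
Lemma sigma_odd_quartic_degenerate a b : a * b = 0 -> a != b ->
  sigma_is (odd_quartic a b) (SigmaSeq [:: (1%N, Plus); (1%N, Minus)]).
Proof.
move=> /eqP; rewrite mulf_eq0 => /orP[]/eqP -> ab.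
  have b0 : b != 0 by rewrite eq_sym.
  apply: (@sigma_two _ b) => //; [|exact: symbol_at_0_triple|exact: symbol_at_pihalf].
  move=> t tpi; rewrite odd_quartic_eq0_itv// mul0r add0r mulf_eq0 (negbTE b0).
  by rewrite sqrf_eq0 sin_eq0_itv//=; case: eqP => //=; rewrite orbF.
apply: (@sigma_two _ a) => //; [|exact: symbol_at_0|exact: symbol_at_pihalf_triple].
move=> t tpi; rewrite odd_quartic_eq0_itv// mul0r addr0 mulf_eq0 (negbTE ab).
by rewrite sqrf_eq0 cos_eq0_itv//= orbb.
Qed.

(** The quadratic factor is definite, so only the axis zeros remain. Multiplying it by a makes it
    positive whatever the common sign of a and b. *)
Lemma sigma_odd_quartic_definite a b : 0 < a * b ->
  sigma_is (odd_quartic a b) (SigmaSeq [:: (1%N, Plus); (1%N, Minus)]).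
Proof.
move=> ab; have a0 : a != 0 by apply: contraTneq ab => ->; rewrite mul0r ltxx.
have b0 : b != 0 by apply: contraTneq ab => ->; rewrite mulr0 ltxx.
apply: (@sigma_two _ a) => //; last 2 first.
- exact: symbol_at_0.
- have -> : sign_of (- a) = sign_of (- b); last exact: symbol_at_pihalf.
  rewrite /sign_of !oppr_gt0; have [aN|aP] := ltP a 0.
    by move: ab; rewrite nmulr_rgt0// => ->.
  have a_gt0 : 0 < a by rewrite lt_neqAle eq_sym a0.
  by move: ab; rewrite pmulr_rgt0// => b_gt0; rewrite ltNge ltW.
move=> t tpi; rewrite odd_quartic_eq0_itv//.
rewrite [X in [|| _, _ | X]](_ : _ = false) ?orbF//; apply/negbTE.
have : 0 < a * (a * cos t ^+ 2 + b * sin t ^+ 2).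
  have -> : a * (a * cos t ^+ 2 + b * sin t ^+ 2) =
    a ^+ 2 * cos t ^+ 2 + a * b * sin t ^+ 2 by ring.
  have a2_gt0 : 0 < a ^+ 2 by rewrite exprn_even_gt0.
  move: ab (sqr_ge0 (cos t)) (sqr_ge0 (sin t)) a2_gt0 (cos2Dsin2 t).
  move: (a * b) (a ^+ 2) (cos t ^+ 2) (sin t ^+ 2) => p q x y p0 x0 y0 q0 xy1.
  have [x_gt0|x_le0] := ltP 0 x.
    by apply: ltr_wpDr; [apply: mulr_ge0 => //; exact: ltW|exact: mulr_gt0].
  have -> : x = 0 by lra.
  have -> : y = 1 by lra.
  by rewrite mulr0 mulr1 add0r.
by apply: contraTneq => ->; rewrite mulr0 ltxx.
Qed.

(** The quadratic factor vanishes exactly when cos^2 = b / (b - a), a number strictly between 0 and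
    1 because a and b have opposite signs. This adds two simple zeros, symmetric about pi/2. *)
Lemma sigma_odd_quartic_indefinite a b : a * b < 0 ->
  sigma_is (odd_quartic a b)
    (SigmaSeq [:: (1%N, Plus); (1%N, Minus); (1%N, Plus); (1%N, Minus)]).
Proof.
move=> ab; have a0 : a != 0 by apply: contraTneq ab => ->; rewrite mul0r ltxx.
have b0 : b != 0 by apply: contraTneq ab => ->; rewrite mulr0 ltxx.
have ba0 : b - a != 0.
  by apply: contraTneq ab => /eqP; rewrite subr_eq0 => /eqP ->; rewrite -leNgt -expr2 sqr_ge0.
pose c := Num.sqrt (b / (b - a)).
have c2_itv : 0 < b / (b - a) < 1.
  apply/andP; split.
    (* Multiplying by (b - a)^2 clears the denominator without fixing its sign; what remains is b^2
       - a b > 0, and a^2 - a b > 0 for the upper bound. *)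
    rewrite -(pmulr_rgt0 _ ((_ : 0 < (b - a) ^+ 2))) ?exprn_even_gt0//.
    rewrite expr2 -mulrA [_ * (b / _)]mulrC divfK//; nra.
  rewrite -subr_gt0 -(pmulr_rgt0 _ ((_ : 0 < (b - a) ^+ 2))) ?exprn_even_gt0//.
  rewrite mulrBr mulr1 {2}expr2 -mulrA [_ * (b / _)]mulrC divfK//; nra.
have c2E : c ^+ 2 = b / (b - a) by rewrite sqr_sqrtr//; lra.
have c_gt0 : 0 < c by rewrite sqrtr_gt0; lra.
have c_lt1 : c < 1 by move: c2_itv; rewrite -c2E; nra.
have ccE : cos (acos c) = c by rewrite acosK// in_itv/=; lra.
have cNE : cos (acos (- c)) = - c by rewrite acosK// in_itv/=; lra.
have cI : 0 < acos c < pi by rewrite acos_gt0 ?acos_ltpi//; lra.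
have cNI : 0 < acos (- c) < pi by rewrite acos_gt0 ?acos_ltpi//; lra.
have simple t : cos t ^+ 2 = b / (b - a) ->
    symbol_at (odd_quartic a b) t (1%N, sign_of (- a)).
  move=> ct; have form0 : a * cos t ^+ 2 + b * sin t ^+ 2 = 0.
    by rewrite sin2cos2 ct; field.
  have evenE : even_quartic a b t = - 2 * cos t ^+ 2 * a.
    (* The derivative is reduced modulo the quadratic form, which vanishes at t; the remainder
       simplifies by cos^2 + sin^2 = 1. *)
    transitivity (- 2 * a * cos t ^+ 2 * (cos t ^+ 2 + sin t ^+ 2)
      + (3 * cos t ^+ 2 - sin t ^+ 2) * (a * cos t ^+ 2 + b * sin t ^+ 2)).
      by rewrite /even_quartic; ring.
    by rewrite form0 cos2Dsin2; ring.
  have c2_gt0 : 0 < 2 * cos t ^+ 2 by rewrite ct; lra.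
  have -> : sign_of (- a) = sign_of (even_quartic a b t).
    by rewrite evenE /sign_of !mulNr !oppr_gt0 pmulr_rlt0.
  apply: symbol_at_simple; first by rewrite odd_quarticE form0 mulr0.
  by rewrite evenE !mulNr oppr_eq0 mulf_neq0// gt_eqF.
have eqE t : (a * cos t ^+ 2 + b * sin t ^+ 2 == 0) = (cos t ^+ 2 == c ^+ 2).
  rewrite sin2cos2 c2E -[RHS](inj_eq (mulfI ba0)) [(b - a) * (b / _)]mulrCA divff// mulr1.
  by rewrite -[RHS]subr_eq0 -[RHS]oppr_eq0; congr (_ == 0); ring.
apply: (@sigma_four _ a (acos c) (acos (- c))) => //; try lra.
(* Cosine decreases on [0, pi], so comparing with pi/2 amounts to knowing the sign of the cosine. *)
- rewrite -ltr_cos ?in_itv/= ?ccE ?cos_pihalf//; have := pihalf_itv; lra.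
- rewrite -ltr_cos ?in_itv/= ?cNE ?cos_pihalf//; have := pihalf_itv; lra.
- move=> t tpi; rewrite odd_quartic_eq0_itv// eqE eqf_sqr -{1}ccE -{1}cNE.
  have [cI' cNI'] : 0 <= acos c < pi /\ 0 <= acos (- c) < pi by split; lra.
  by rewrite !cos_eq_itv// [(t == pi / 2) || _]orbCA.
- exact: symbol_at_0.
- by apply: simple; rewrite ccE.
- have -> : sign_of a = sign_of (- b); last exact: symbol_at_pihalf.
  rewrite /sign_of oppr_gt0; have [aP|aN] := ltP 0 a.
    by move: ab; rewrite pmulr_rlt0// => ->.
  have a_lt0 : a < 0 by rewrite lt_neqAle a0.
  by move: ab; rewrite nmulr_rlt0// => b_gt0; rewrite ltNge ltW.
- by apply: simple; rewrite cNE sqrrN.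
Qed.

End Trigonometric.

(** * Return to the cubic field and conclusion *)

Lemma phase_cubic_field (R : realType) (a10 a11 a20 a21 : R) :
  phase (cubic_field a10 a11 a20 a21) = odd_quartic (a10 - a20) (a11 - a21).
Proof.
by apply/funext => t; rewrite /phase /LQ dotE !mxE /= /odd_quartic; ring.
Qed.

(** Contraction is tested on the unit vectors (1, 0) and (0, 1). Positivity of these coefficients
    yields equilibria on both axes. *)
Lemma contracting_axes (R : realType) (a10 a11 a20 a21 : R) :
  contracting (cubic_field a10 a11 a20 a21) -> 0 < a10 /\ 0 < a21.
Proof.
have enorm_axis (x y : R) : x ^+ 2 + y ^+ 2 = 1 -> enorm (vec2 x y) = 1.
  by move=> xy; rewrite /enorm dotE !mxE /= -!expr2 xy sqrtr1.
move=> contr.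
have := contr _ (@enorm_axis 1 0 ltac:(ring)).
have := contr _ (@enorm_axis 0 1 ltac:(ring)).
by rewrite !dotE !mxE /=; split; lra.
Qed.

(** The witness is (r, 0) with r^2 = lambda / a10, whose transverse eigenvalue is zero. Since B is
    nonzero, a nonhyperbolic equilibrium on C must lie on this axis, where the equilibrium equation
    leaves only the antipodal pair. *)
Lemma axis0_unique_not_hyperbolic (R : realType) (lambda a10 a11 a20 a21 : R)
    (C : set 'rV[R]_2) (F := full_field lambda (cubic_field a10 a11 a20 a21)) :
  0 < lambda -> 0 < a10 -> a10 = a20 -> a21 != a11 -> invariant_circle F C ->
  exists X : 'rV[R]_2, [/\ C X, equilibrium F X, ~ hyperbolic F X
    & forall Y : 'rV[R]_2, C Y -> equilibrium F Y ->
        ~ hyperbolic F Y -> Y = X \/ Y = - X].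
Proof.
move=> l0 a10_gt0 aE aN circ; pose r := Num.sqrt (lambda / a10).
have r2E : r ^+ 2 = lambda / a10 by rewrite sqr_sqrtr// divr_ge0// ltW.
have r_neq0 : r != 0 by rewrite gt_eqF// sqrtr_gt0 divr_gt0.
have a10_neq0 : a10 != 0 by rewrite gt_eqF.
have lE : lambda = a10 * r ^+ 2 by rewrite r2E mulrCA divff// mulr1.
have eqX : equilibrium F (vec2 r 0).
  by apply/axis0_equilibrium; rewrite ?vec2E0 ?vec2E1.
exists (vec2 r 0); split => //.
- apply: equilibrium_in_invariant_circle circ eqX _.
  by apply: contraNneq r_neq0 => /rowP/(_ 0); rewrite vec2E0 mxE => ->.
- by apply: axis0_not_hyperbolic; rewrite ?vec2E0 ?vec2E1.
move=> Y CY eqY nhypY.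
have Y_neq0 : Y != 0 by apply/eqP => Y0; case: circ => _ + _ _ _; rewrite -Y0.
have Y1 : Y 0 1 = 0.
  apply/eqP/negPn/negP => Y1; apply: nhypY; apply: full_field_hyperbolic => //.
  - by right; rewrite subr_eq0.
  - by rewrite subr_eq0.
  - by move=> /eqP; rewrite (negbTE Y1).
have Y0 : Y 0 0 != 0.
  by apply: contraNneq Y_neq0 => Y0; apply/eqP/rV2P; rewrite !mxE.
have : Y 0 0 ^+ 2 = r ^+ 2.
  apply: (mulfI a10_neq0); rewrite -lE; apply: esym.
  exact: (@axis0_equilibrium _ lambda a10 a11 a20 a21 _ Y1 Y0).1 eqY.
move=> /eqP; rewrite eqf_sqr => /orP[]/eqP Y0E; [left|right];
  by apply: rV2P; rewrite !mxE//= ?oppr0.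
Qed.

Lemma axis1_unique_not_hyperbolic (R : realType) (lambda a10 a11 a20 a21 : R)
    (C : set 'rV[R]_2) (F := full_field lambda (cubic_field a10 a11 a20 a21)) :
  0 < lambda -> 0 < a21 -> a11 = a21 -> a10 != a20 -> invariant_circle F C ->
  exists X : 'rV[R]_2, [/\ C X, equilibrium F X, ~ hyperbolic F X
    & forall Y : 'rV[R]_2, C Y -> equilibrium F Y ->
        ~ hyperbolic F Y -> Y = X \/ Y = - X].
Proof.
move=> l0 a21_gt0 aE aN circ; pose r := Num.sqrt (lambda / a21).
have r2E : r ^+ 2 = lambda / a21 by rewrite sqr_sqrtr// divr_ge0// ltW.
have r_neq0 : r != 0 by rewrite gt_eqF// sqrtr_gt0 divr_gt0.
have a21_neq0 : a21 != 0 by rewrite gt_eqF.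
have lE : lambda = a21 * r ^+ 2 by rewrite r2E mulrCA divff// mulr1.
have eqX : equilibrium F (vec2 0 r).
  by apply/axis1_equilibrium; rewrite ?vec2E0 ?vec2E1.
exists (vec2 0 r); split => //.
- apply: equilibrium_in_invariant_circle circ eqX _.
  by apply: contraNneq r_neq0 => /rowP/(_ 1); rewrite vec2E1 mxE => ->.
- by apply: axis1_not_hyperbolic; rewrite ?vec2E0 ?vec2E1.
move=> Y CY eqY nhypY.
have Y_neq0 : Y != 0 by apply/eqP => Y0; case: circ => _ + _ _ _; rewrite -Y0.
have Y0 : Y 0 0 = 0.
  apply/eqP/negPn/negP => Y0; apply: nhypY; apply: full_field_hyperbolic => //.
  - by left; rewrite subr_eq0.
  - by move=> /eqP; rewrite (negbTE Y0).
  - by rewrite subr_eq0.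
have Y1 : Y 0 1 != 0.
  by apply: contraNneq Y_neq0 => Y1; apply/eqP/rV2P; rewrite !mxE.
have : Y 0 1 ^+ 2 = r ^+ 2.
  apply: (mulfI a21_neq0); rewrite -lE; apply: esym.
  exact: (@axis1_equilibrium _ lambda a10 a11 a20 a21 _ Y0 Y1).1 eqY.
move=> /eqP; rewrite eqf_sqr => /orP[]/eqP Y1E; [left|right];
  by apply: rV2P; rewrite !mxE//= ?oppr0.
Qed.

Theorem proposition7p4 (R : realType) (lambda a10 a11 a20 a21 : R) :
  let Q := cubic_field a10 a11 a20 a21 in
  let F := full_field lambda Q in
  let A := a10 - a20 in
  let B := a21 - a11 in
  0 < lambda ->
  contracting Q ->
  [/\ (A = 0 -> B = 0 -> sigma_is (phase Q) SigmaInfty),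
      (A * B = 0 -> A + B != 0 ->
         sigma_is (phase Q) (SigmaSeq [:: (1%N, Plus); (1%N, Minus)]) /\
         forall C : set 'rV[R]_2, invariant_circle F C ->
           exists X : 'rV[R]_2,
             [/\ C X, equilibrium F X, ~ hyperbolic F X
               & forall Y : 'rV[R]_2, C Y -> equilibrium F Y ->
                   ~ hyperbolic F Y -> Y = X \/ Y = - X]),
      (A * B < 0 ->
         sigma_is (phase Q) (SigmaSeq [:: (1%N, Plus); (1%N, Minus)]) /\
         forall C : set 'rV[R]_2, invariant_circle F C ->
           forall X : 'rV[R]_2, C X -> equilibrium F X -> hyperbolic F X)
    & (A * B > 0 ->
         sigma_is (phase Q)
           (SigmaSeq [:: (1%N, Plus); (1%N, Minus);
                         (1%N, Plus); (1%N, Minus)]) /\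
         forall C : set 'rV[R]_2, invariant_circle F C ->
           forall X : 'rV[R]_2, C X -> equilibrium F X -> hyperbolic F X)].
Proof.
move=> Q F A B l0 contr; have [a10_gt0 a21_gt0] := contracting_axes contr.
(* Cases (III) and (IV) share this argument; C avoids the origin, so its equilibria are nonzero. *)
have hyp C : invariant_circle F C -> A * B != 0 ->
    forall X, C X -> equilibrium F X -> hyperbolic F X.
  move=> [_ C0 _ _ _]; rewrite mulf_eq0 negb_or => /andP[A0 B0] X CX eqX.
  apply: full_field_hyperbolic => //; last by left.
  by apply: contra_notN C0 => /eqP <-.
(* The second coefficient is -B, so the sign of A B is reversed: (III) is the definite case and (IV)
   the indefinite one. *)
rewrite /Q phase_cubic_field -/A (_ : a11 - a21 = - B); last by rewrite opprB.
split.
- by move=> -> -> t; rewrite odd_quarticE; ring.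
- move=> AB0 AB; split.
    apply: sigma_odd_quartic_degenerate; first by rewrite mulrN AB0 oppr0.
    by rewrite -subr_eq0 opprK.
  move=> C circ; move/eqP: AB0 AB; rewrite mulf_eq0 => /orP[]/eqP.
    move=> A0; rewrite A0 add0r subr_eq0 => a21N.
    by apply: axis0_unique_not_hyperbolic circ => //; exact/subr0_eq.
  move=> B0; rewrite B0 addr0 subr_eq0 => a10N.
  by apply: axis1_unique_not_hyperbolic circ => //; exact/esym/subr0_eq.
- move=> AB; split => [|C circ]; last by apply: hyp circ _; rewrite lt_eqF.
  by apply: sigma_odd_quartic_definite; rewrite mulrN oppr_gt0.
- move=> AB; split => [|C circ]; last by apply: hyp circ _; rewrite gt_eqF.
  by apply: sigma_odd_quartic_indefinite; rewrite mulrN oppr_lt0.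
Qed.
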